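(* Let $\mathbb K$ be a field of characteristic $0$ and $x\in\mathbb K$. Write $[p_1,\dots,p_n]$ for the dissection diagram of degree $n$ with chords $i\to p_i$ ($1\le i\le n$), and put $a=[0]$, $Y=[2,0]$, $X=[0,0]$, $W=[0,1]$. A basis of the vector space $\mathrm{Prim}(\mathcal H_D)_3$ of primitive elements of degree $3$ of $\mathcal H_D$ is given by $\{V_1,\dots,V_9\}$, where $$\begin{aligned} V_1&=[0,1,0]-x[2,0,0]+x[0,0,2]-(1+x)Wa-(1+x^2)Xa+xYa+(x^2+1)a^3,\\ V_2&=[0,1,2]-x^2[2,0,0]+x[0,1,1]-(1+x)^2Wa+x(x-1)Xa+x^2Ya+\tfrac{x^3-x^2+5x+1}{3}a^3,\\ V_3&=[0,0,2]-[0,0,0]-Wa-(x-2)Xa+(x-1)a^3,\\ V_4&=[2,0,2]-[3,3,0]-Wa+Xa-(x-1)Ya+(x-1)a^3,\\ V_5&=[0,3,1]-(1+x)[0,0,0]+[2,0,2]-2Wa+2(1+x)Xa-(1+x)Ya,\\ V_6&=[3,1,0]-[2,0,2],\\ V_7&=[2,0,0]-[3,1,0]+Wa-Xa+(x-1)Ya-(x-1)a^3,\\ V_8&=[0,3,0]-2Xa-Ya+2a^3,\\ V_9&=[2,3,0]-3Ya+2a^3. \end{aligned}$$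
   Context: Dissection diagrams. For $n\ge 0$ let $\Pi_n$ be the regular $(n+1)$-gon with vertices $0,1,\dots,n$ numbered clockwise; vertex $0$ is the root. For $0\le i\le n$, side $i$ goes from vertex $i$ to vertex $i+1$ (with $n+1$ read as $0$). A chord is a segment joining two distinct vertices (adjacent vertices are allowed; such a chord is distinct from the side). A dissection diagram of degree $n$ is a set of $n$ pairwise non-crossing chords (they may share endpoints) of $\Pi_n$ forming an acyclic graph, hence a spanning tree on $\{0,\dots,n\}$. All chords are oriented towards the root, so each vertex $i\in\{1,\dots,n\}$ has exactly one outgoing chord. $\mathrm{Ch}(D)$ is the set of chords of $D$. The diagram of degree $0$ is identified with $1$. Coproduct. $\mathcal H_D$ is the commutative polynomial algebra on dissection diagrams of positive degree, graded by degree, with $\Delta(D)=\sum_{C\subset \mathrm{Ch}(D)}x^{k_C(D)}q_C(D)\otimes r_C(D)$ (with $x^0=1$), extended multiplicatively; it is a graded connected Hopf algebra. Here the $p=|C|$ chords of $C$ cut the polygon into $p+1$ faces; for a face $\alpha$ let $S_C(\alpha)$ be the (nonempty) set of sides of the polygon bordering $\alpha$. $q_C(D)$ is obtained by contracting every chord of $C$ to a point: each face $\alpha$ becomes a polygon with set of sides $S_C(\alpha)$, rooted at the starting vertex of its side of minimal label, carrying the chords of $D$ not in $C$ that lie in $\alpha$; this is a dissection diagram, and $q_C(D)$ is the product of these over all faces. $r_C(D)$ is the dissection diagram of degree $p$ obtained by keeping the chords of $C$ and contracting all sides which are not the minimal side of their face, the root being the image of $0$. $k_C(D)$ is the number of chords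 of $C$ whose orientation in $D$ is opposite to their orientation (towards the root) in $r_C(D)$. *)

(* Defs.v *)
From HB Require Import structures.
From mathcomp Require Import all_boot all_order all_algebra.
From mathcomp Require Import finmap.
From mathcomp.multinomials Require Import monalg.

Set Implicit Arguments.
Unset Strict Implicit.
Unset Printing Implicit Defensive.

Import GRing.Theory.

(* -------------------------------------------------------------------------- *)
(* Dissection diagrams. The polygon with vertices 0, ..., n has sides         *)
(* 0, ..., n, side i going from vertex i to vertex i + 1 (mod n + 1).         *)
(* A chord {u, v} is encoded as the pair (u, v) with u < v, and a finite set  *)
(* of chords as its list of elements in increasing lexicographic order; the   *)
(* degree of a diagram is then the size of the list.                          *)
(* -------------------------------------------------------------------------- *)

Definition chord : Type := (nat * nat)%type.

Definition mkchord (u v : nat) : chord := (minn u v, maxn u v).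

Definition chord_le (c d : chord) : bool :=
  (c.1 < d.1)%N || (c.1 == d.1) && (c.2 <= d.2)%N.

Definition crossing (c d : chord) : bool :=
  [&& c.1 < d.1, d.1 < c.2 & c.2 < d.2]%N ||
  [&& d.1 < c.1, c.1 < d.2 & d.2 < c.2]%N.

Definition adjacent (E : seq chord) : rel nat :=
  fun u v => mkchord u v \in E.

(* There is a walk from u to v along at most k chords of E. *)
Fixpoint walk (k : nat) (E : seq chord) (u v : nat) : bool :=
  if u == v then true else
  if k is k'.+1 then
    has (fun c => if c.1 == u then walk k' E c.2 v
                  else if c.2 == u then walk k' E c.1 v else false) E
  else false.

Definition linked (E : seq chord) (u v : nat) : bool :=
  walk (size E).*2 E u v.

(* The bound on the length of walks is harmless. *)
Lemma linkedP (E : seq chord) (u v : nat) :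
  all (fun c => c.1 < c.2)%N E ->
  reflect (exists2 p, path (adjacent E) u p & v = last u p) (linked E u v).
Proof.
move=> /allP ltE.
have mkE c : c \in E -> mkchord c.1 c.2 = c /\ mkchord c.2 c.1 = c.
  move=> /ltE lc; rewrite /mkchord (minn_idPl (ltnW lc)) (maxn_idPr (ltnW lc)).
  by rewrite (minn_idPr (ltnW lc)) (maxn_idPl (ltnW lc)); case: c {lc}.
rewrite /linked; apply: (iffP idP).
  elim: (size E).*2 u => [|k IHk] u /=.
    by case: eqP => // -> _; exists [::].
  case: (u =P v) => [->|_]; first by exists [::].
  case/hasP=> c cE; have [m1 m2] := mkE c cE.
  case: eqP => [<- /IHk[p pp ->]|_].
    by exists (c.2 :: p); rewrite //= /adjacent m1 cE.
  case: eqP => [<- /IHk[p pp ->]|//].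
  by exists (c.1 :: p); rewrite //= /adjacent m2 cE.
case=> p0 pp0 ->; case/shortenP: pp0 => p pp /andP[_ Up] _ {p0}.
have sp : (size p <= (size E).*2)%N.
  have -> : (size E).*2 = size ([seq c.1 | c <- E] ++ [seq c.2 | c <- E]).
    by rewrite size_cat !size_map addnn.
  apply: uniq_leq_size => //; elim: p u pp {Up} => //= w p IHp u.
  case/andP=> uw /IHp{}IHp z; rewrite inE => /predU1P[->|/IHp//].
  rewrite mem_cat; have [le|lt] := leqP w u.
    by rewrite (_ : w = (mkchord u w).1) ?map_f //= (minn_idPr le).
  by rewrite orbC (_ : w = (mkchord u w).2) ?map_f //= (maxn_idPr (ltnW lt)).
elim: (size E).*2 p u pp sp {Up} => [|k IHk] [|w p] u //=; rewrite ?eqxx //.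
case/andP=> uw pp; rewrite ltnS => /(IHk _ _ pp) Hw; case: ifP => // _.
apply/hasP; exists (mkchord u w) => //=; have := ltE _ uw.
rewrite /mkchord /=; case: (leqP u w) => [le|lt] /= _.
  by rewrite eqxx.
by rewrite (ltn_eqF lt) eqxx.
Qed.

(* No cycle goes through c: the other chords do not join its endpoints. *)
Definition acyclic (E : seq chord) : bool :=
  all (fun c => ~~ linked (rem c E) c.1 c.2) E.

Definition dissection (D : seq chord) : bool :=
  [&& sorted chord_le D, uniq D,
      all (fun c => (c.1 < c.2) && (c.2 <= size D))%N D,
      all (fun c => all (fun d => ~~ crossing c d) D) D
    & acyclic D].

(* The starting point of the chord c of D, oriented towards the root 0: when  *)
(* c is removed, its other endpoint is still linked to the root.              *)
Definition source (D : seq chord) (c : chord) : nat :=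
  if linked (rem c D) 0 c.1 then c.2 else c.1.

(* The set of chords i -> p_i (1 <= i <= n), for p = [:: p_1; ...; p_n]. *)
Definition diagram_of (p : seq nat) : seq chord :=
  sort chord_le [seq mkchord i.+1 (nth 0 p i) | i <- iota 0 (size p)].

(* The chord c has on one side the vertices c.1, ..., c.2 and the sides       *)
(* c.1, ..., c.2 - 1 of the polygon, and on the other side the vertices       *)
(* c.2, ..., n, 0, ..., c.1 and the remaining sides of the polygon.           *)
Definition beyond (c : chord) (s : nat) : bool := (c.1 <= s < c.2)%N.

Definition same_face (C : seq chord) (s t : nat) : bool :=
  all (fun c => beyond c s == beyond c t) C.

(* A face is represented by the increasing list of the sides bordering it. *)
Definition face (n : nat) (C : seq chord) (s : nat) : seq nat :=
  [seq t <- iota 0 n.+1 | same_face C s t].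

Definition minsides (n : nat) (C : seq chord) : seq nat :=
  [seq s <- iota 0 n.+1 | s == head 0 (face n C s)].

(* A face is the intersection of the half-polygons, one for each c in C, that *)
(* contain it; d lies in the face of side s when it lies in all of these.     *)
Definition in_face (C : seq chord) (s : nat) (d : chord) : bool :=
  all (fun c =>
    if beyond c s then (c.1 <= d.1)%N && (d.2 <= c.2)%N
    else all (fun u => (u <= c.1) || (c.2 <= u))%N [:: d.1; d.2]) C.

(* The image of the vertex u in the polygon with set of sides S (an           *)
(* increasing list), everything else on the boundary being contracted and the *)
(* root being the starting vertex of the first side of S: u is sent to the    *)
(* starting vertex of the first side of S found from u on (cyclically).       *)
Definition contract (S : seq nat) (u : nat) : nat :=
  (count (fun s => s < u)%N S %% size S)%N.

Definition contract_chords (S : seq nat) (E : seq chord) : seq chord :=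
  sort chord_le [seq mkchord (contract S c.1) (contract S c.2) | c <- E].

(* The factor of q_C(D) given by the face of side s. *)
Definition q_face (D C : seq chord) (s : nat) : seq chord :=
  contract_chords (face (size D) C s)
    [seq d <- D | (d \notin C) && in_face C s d].

Definition r_cut (D C : seq chord) : seq chord :=
  contract_chords (minsides (size D) C) C.

Definition k_cut (D C : seq chord) : nat :=
  let f := contract (minsides (size D) C) in
  count (fun c => f (source D c) != source (r_cut D C) (mkchord (f c.1) (f c.2)))
    C.

Fixpoint subsets (D : seq chord) : seq (seq chord) :=
  if D is c :: D' then [seq c :: C | C <- subsets D'] ++ subsets D'
  else [:: [::]].

Definition diagrams (n : nat) : seq (seq chord) :=
  let chords := [seq (u, v) | u <- iota 0 n.+1, v <- iota u.+1 (n - u)] in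
  [seq D <- [seq D <- subsets chords | size D == n] | dissection D].

Fact size_diagrams : [seq size (diagrams n) | n <- iota 0 5] = [:: 1; 1; 3; 12; 55].
Proof. by vm_compute. Qed.

(* Cutting diagrams of degree at most 4 yields diagrams. *)
Fact cut_dissection :
  all (fun n => all (fun D => all (fun C =>
    [&& dissection (r_cut D C), size (r_cut D C) == size C
      & all (fun s => dissection (q_face D C s)
                   && (size (q_face D C s) == (size (face n C s)).-1))
          (minsides n C)]) (subsets D)) (diagrams n)) (iota 0 5).
Proof. by vm_compute. Qed.

(* -------------------------------------------------------------------------- *)
(* The algebra H_D = K[diagram] and its tensor square. H_D has the monomials  *)
(* in the diagrams as a basis over K, so H_D (x) H_D has the pairs of         *)
(* monomials as a basis: (m1, m2) stands for m1 (x) m2.                       *)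
(* -------------------------------------------------------------------------- *)

Definition diagram : Type :=
  {D : seq chord | dissection D && (0 < size D)%N}.

HB.instance Definition _ := Choice.on diagram.

Local Open Scope ring_scope.

Section PairMonomials.
Variables M N : conomType.

Let pmul (m n : M * N) : M * N := (mmul m.1 n.1, mmul m.2 n.2).

Let pmulA : associative pmul.
Proof. by move=> ? ? ?; rewrite /pmul /= !mulmA. Qed.
Let pmul1m : left_id (@mone M, @mone N) pmul.
Proof. by case=> ? ?; rewrite /pmul /= !mul1m. Qed.
Let pmulm1 : right_id (@mone M, @mone N) pmul.
Proof. by case=> ? ?; rewrite /pmul /= !mulm1. Qed.
Let punitm m n : pmul m n = (mone, mone) -> m = (mone, mone) /\ n = (mone, mone).
Proof. by case: m n => [? ?] [? ?] [/unitm[-> ->] /unitm[-> ->]]. Qed.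
Let pmulC : commutative pmul.
Proof. by move=> ? ?; rewrite /pmul mulmC [mmul _.2 _]mulmC. Qed.

HB.instance Definition _ :=
  Choice_isMonomialDef.Build (M * N)%type pmulA pmul1m pmulm1 punitm.
HB.instance Definition _ := MonomialDef_isConomialDef.Build (M * N)%type pmulC.
End PairMonomials.

Notation HD K := {malg K[{cmonom diagram}]}.
Notation HD2 K := {malg K[({cmonom diagram} * {cmonom diagram})%type]}.

Definition tens (K : fieldType) (P Q : HD K) : HD2 K :=
  \sum_(m <- msupp P) \sum_(n <- msupp Q) << P@_m * Q@_n *g (m, n) >>.

(* The element of H_D given by a dissection diagram, the diagram of degree 0  *)
(* being 1. The value 0 on lists which are not diagrams is a dummy one, which *)
(* is not used since cutting a diagram always yields diagrams.                *)
Definition gen (K : fieldType) (D : seq chord) : HD K :=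
  if D == [::] then 1
  else if insub D is Some d then << ucm (d : diagram) >> else 0.

Definition bracket (K : fieldType) (p : seq nat) : HD K := gen K (diagram_of p).

Section Coproduct.
Variables (K : fieldType) (x : K).

Definition q_cut (D C : seq chord) : HD K :=
  \prod_(s <- minsides (size D) C) gen K (q_face D C s).

Definition Delta_gen (D : seq chord) : HD2 K :=
  \sum_(C <- subsets D)
    x ^+ k_cut D C *: tens (q_cut D C) (gen K (r_cut D C)).

(* The extension of Delta_gen to a morphism of algebras. *)
Definition Delta : HD K -> HD2 K :=
  mmap (fun c : K => c%:A)
    (fun m : {cmonom diagram} =>
       \prod_(d <- finsupp m) Delta_gen (val d) ^+ m d).

Definition mon_degree (m : {cmonom diagram}) : nat :=
  (\sum_(d <- finsupp m) m d * size (val d))%N.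

Definition homogeneous (n : nat) (P : HD K) : Prop :=
  {in msupp P, forall m, mon_degree m = n}.

Definition primitive (P : HD K) : Prop := Delta P = tens P 1 + tens 1 P.

Definition Prim (n : nat) (P : HD K) : Prop := homogeneous n P /\ primitive P.

End Coproduct.

Definition is_basis (K : fieldType) (M : lmodType K) (U : M -> Prop)
    (n : nat) (v : 'I_n -> M) : Prop :=
  [/\ forall i, U (v i),
      forall c : 'I_n -> K, \sum_i c i *: v i = 0 -> forall i, c i = 0
    & forall w, U w -> exists c : 'I_n -> K, w = \sum_i c i *: v i].

(* Main.v *)
From HB Require Import structures.
Require Import Defs.
From mathcomp Require Import all_boot all_order all_algebra.
From mathcomp Require Import finmap.
From mathcomp.multinomials Require Import monalg.
From mathcomp Require Import ring zify.

(** Why the nine elements form a basis.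

    In degree 3, the algebra H_D has a basis of sixteen monomials: the twelve
    diagrams of degree 3, the products W a, X a, Y a, and a^3
    ([homogeneous3_span]). Let H_2 be the span of X, W, Y and a^2. As a is the
    only diagram of degree 1, the reduced coproduct Delta P - P (x) 1 - 1 (x) P
    of an element P of degree 3 has the form A (x) a + a (x) B with A and B in
    H_2. So the primitive elements of degree 3 are the kernel of a matrix with
    sixteen rows and eight columns, whose entries are polynomials in x. The
    lemmas [reduced_010], ..., [reduced_a3] are the rows of this matrix.

    That V_1, ..., V_9 lie in the kernel is then an identity between
    polynomials in x; the cubic numerator in V_2 is divided by 3, which is
    possible in characteristic 0. For the basis property, nine of the twelve
    diagrams serve as pivots.
    - Up to signs and the order of the rows, the matrix of the coordinates of
      V_1, ..., V_9 on the pivots is unitriangular ([dc_combination]). Hence the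
      V_i are independent, and exactly one combination of them has prescribed
      coordinates on the pivots.
    - A primitive element of degree 3 whose coordinates on the pivots vanish is
      zero ([pivots_injective]): it is a combination of the seven other
      monomials, and the eight columns of the matrix force its coefficients to
      vanish, after divisions by 2 and 3 ([residual_eq0]).
    Subtracting from a primitive w the combination of the V_i with the same
    coordinates on the pivots therefore leaves 0.

    The rows of the matrix are obtained as follows. With L P = P (x) 1 and
    R P = 1 (x) P, both morphisms of algebras, P (x) Q is L P * R Q, so that
    every coproduct is an expression in a commutative ring. The cuts of a
    diagram of degree at most 3 are evaluated, each diagram being named by the
    list p of the endpoints of its chords i -> p_i, as in the brackets
    [p_1, ..., p_n]; the morphism property of Delta then gives the coproducts of
    W a, X a, Y a and a^3.

    The linear algebra uses few properties of H_D and of its coproduct, and it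
    is carried out for an arbitrary commutative algebra H having them: there the
    diagrams are plain variables, and the identities between coproducts are
    identities of commutative rings. *)

Set Implicit Arguments.
Unset Strict Implicit.
Unset Printing Implicit Defensive.

Import GRing.Theory.
Local Open Scope ring_scope.

(** * Monoid algebras and linear combinations *)

Lemma malgUM (K : nzRingType) (M : monomType) (m n : M) :
  << m >> * << n >> = << mmul m n >> :> {malg K[M]}.
Proof. by rewrite malgM_def fgmulUU mulr1. Qed.

Lemma malgU_scale (K : nzRingType) (M : choiceType) (c : K) (m : M) :
  << c *g m >> = c *: << m >> :> {malg K[M]}.
Proof. by apply/malgP => k; rewrite mcoeffZ !mcoeffU mulr_natr. Qed.

Lemma scaleX_alg (K : fieldType) (A : comAlgType K) c k (u : A) :
  c ^+ k *: u = c%:A ^+ k * u.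
Proof. by rewrite exprZn expr1n mulr_algl. Qed.

Lemma lincomb_seq (K : nzRingType) (V : lmodType K) (B : seq V)
    (I : eqType) (r : seq I) (F : I -> V) (c : I -> K) :
  {in r, forall i, F i \in B} ->
  exists d : nat -> K,
    \sum_(i <- r) c i *: F i = \sum_(j < size B) d j *: B`_j.
Proof.
move=> FB; rewrite big_seq; elim/big_ind: _ => [|u v [d ->] [e ->]|i /FB iB].
- by exists (fun=> 0); rewrite big1 // => j _; rewrite scale0r.
- exists (fun j => d j + e j); rewrite -big_split.
  by apply: eq_bigr => j _; rewrite scalerDl.
have jB : (index (F i) B < size B)%N by rewrite index_mem.
exists (fun j => if j == index (F i) B then c i else 0).
rewrite (bigD1 (Ordinal jB)) //= eqxx nth_index // big1 ?addr0 // => j /negPf.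
by rewrite -val_eqE /= => ->; rewrite scale0r.
Qed.

Lemma eq_sub0r (V : zmodType) (u v : V) : u = v <-> u - v = 0.
Proof. by split=> [->|/eqP]; rewrite ?subrr // subr_eq0 => /eqP. Qed.

(** * The tensor square *)

Section TensorSquare.
Variables (K : fieldType) (M : conomType).
Implicit Types P Q : {malg K[M]}.

Definition tensl_mon (m : M) : {malg K[(M * M)%type]} := << (m, mone) >>.
Definition tensr_mon (m : M) : {malg K[(M * M)%type]} := << (mone, m) >>.

Fact tensl_mon_morph : mmorphism tensl_mon.
Proof. by split=> // m n; rewrite malgUM [mmul (m, _) _]/mmul /= mulm1. Qed.

Fact tensr_mon_morph : mmorphism tensr_mon.
Proof. by split=> // m n; rewrite malgUM [mmul (_, m) _]/mmul /= mulm1. Qed.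

HB.instance Definition _ :=
  isMultiplicative.Build M _ tensl_mon tensl_mon_morph.
HB.instance Definition _ :=
  isMultiplicative.Build M _ tensr_mon tensr_mon_morph.

(** The morphisms P |-> P (x) 1 and P |-> 1 (x) P, given on monomials so that
    their multiplicativity is that of a map induced by a morphism of monoids. *)
Definition tensl : {malg K[M]} -> {malg K[(M * M)%type]} :=
  mmap (@malgC (M * M)%type K) tensl_mon.
Definition tensr : {malg K[M]} -> {malg K[(M * M)%type]} :=
  mmap (@malgC (M * M)%type K) tensr_mon.

HB.instance Definition _ := GRing.RMorphism.on tensl.
HB.instance Definition _ := GRing.RMorphism.on tensr.

Lemma tensl_tensr P Q :
  tensl P * tensr Q
  = \sum_(m <- msupp P) \sum_(n <- msupp Q) << P@_m * Q@_n *g (m, n) >>.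
Proof.
rewrite /tensl /tensr /mmap mulr_suml; apply: eq_bigr => m _.
rewrite mulr_sumr; apply: eq_bigr => n _.
rewrite !mul_malgC -scalerAl -scalerAr scalerA malgUM [mmul _ _]/mmul /=.
by rewrite mulm1 mul1m -malgU_scale.
Qed.

Lemma tensl_tensr1 P : tensl P * tensr 1 = tensl P.
Proof. by rewrite rmorph1 mulr1. Qed.

Lemma tensl1_tensr P : tensl 1 * tensr P = tensr P.
Proof. by rewrite rmorph1 mul1r. Qed.

Lemma mcoeff_tensl_tensr P Q m n :
  (tensl P * tensr Q)@_(m, n) = P@_m * Q@_n.
Proof.
rewrite tensl_tensr.
rewrite raddf_sum [in RHS](monalgE P) raddf_sum mulr_suml.
apply: eq_bigr => k _ /=.
rewrite raddf_sum [in RHS](monalgE Q) raddf_sum mulr_sumr.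
apply: eq_bigr => l _ /=.
rewrite !mcoeffU xpair_eqE; case: (k == m); case: (l == n);
 by rewrite /= ?mulr1n ?mulr0n ?mulr0 ?mul0r.
Qed.

Lemma tenslZ c P : tensl (c *: P) = c%:A * tensl P.
Proof. by rewrite /tensl mmapZ -[c%:A]mul_malgC mulr1. Qed.

Lemma tensrZ c P : tensr (c *: P) = c%:A * tensr P.
Proof. by rewrite /tensr mmapZ -[c%:A]mul_malgC mulr1. Qed.
End TensorSquare.

(** * Polynomial algebras are free *)

Section Extension.
Local Open Scope fset_scope.
Variables (K : fieldType) (I : choiceType) (A : comAlgType K) (g : I -> A).

Definition ext_mon (m : {cmonom I}) : A := \prod_(i <- finsupp m) g i ^+ m i.

Lemma ext_monE (E : {fset I}) (m : {cmonom I}) :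
  finsupp m `<=` E -> ext_mon m = \prod_(i <- E) g i ^+ m i.
Proof.
move=> le; rewrite /ext_mon (big_fset_incl _ le) // => i _.
by rewrite -cmE_neq0 negbK => /eqP->.
Qed.

Fact ext_mon_morph : mmorphism ext_mon.
Proof.
split=> [m n|]; last by rewrite /ext_mon mdom1 big_seq_fset0.
rewrite {1}/ext_mon mdomD (ext_monE (fsubsetUl _ (finsupp n))).
rewrite (ext_monE (fsubsetUr (finsupp m) _)) -big_split /=.
by apply: eq_bigr => i _; rewrite cmM exprD.
Qed.

HB.instance Definition _ :=
  isMultiplicative.Build {cmonom I} A ext_mon ext_mon_morph.

(** The morphism of algebras that extends g to K[I]. *)
Definition ext : {malg K[{cmonom I}]} -> A := mmap (in_alg A) ext_mon.

HB.instance Definition _ := GRing.RMorphism.on ext.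

Lemma extZ c P : ext (c *: P) = c%:A * ext P.
Proof. by rewrite /ext mmapZ. Qed.

Lemma ext_ucm i : ext << ucm i >> = g i.
Proof.
by rewrite /ext mmapU /= scale1r mul1r /ext_mon mdomU big_seq_fset1 cmUU expr1.
Qed.
End Extension.

(** * Diagrams of degree at most 3 and their cuts *)

(** The list p with D = [p_1, ..., p_n]: the chord of source i goes to its other
    endpoint, which is the sum of its two endpoints minus i. *)
Definition code (D : seq chord) : seq nat :=
  [seq head 0%N [seq (c.1 + c.2 - i)%N | c <- D & source D c == i]
     | i <- iota 1 (size D)].

Definition codes n := [seq code D | D <- diagrams n].

Definition codes1 := [:: [:: 0]]%N.
Definition codes2 := [:: [:: 0; 1]; [:: 0; 0]; [:: 2; 0]]%N.

(** The first nine of these diagrams are the pivots, in an order in which the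
    i-th one appears in V_i with coefficient 1 or -1. *)
Definition codes3 := [:: [:: 0; 1; 0]; [:: 0; 1; 2]; [:: 0; 0; 2]; [:: 3; 3; 0];
  [:: 0; 3; 1]; [:: 3; 1; 0]; [:: 2; 0; 0]; [:: 0; 3; 0]; [:: 2; 3; 0];
  [:: 0; 1; 1]; [:: 0; 0; 0]; [:: 2; 0; 2]]%N.

Lemma mem_codes1 : codes 1 =i codes1.
Proof. by apply: perm_mem; vm_compute. Qed.
Lemma mem_codes2 : codes 2 =i codes2.
Proof. by apply: perm_mem; vm_compute. Qed.
Lemma mem_codes3 : codes 3 =i codes3.
Proof. by apply: perm_mem; vm_compute. Qed.

(** One entry (k, (q, r)) for each set C of chords: it stands for the term
    x^k q (x) r of the coproduct, where the faces of degree 0 are left out of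
    the product q. *)
Definition cut_codes (p : seq nat) : seq (nat * (seq (seq nat) * seq nat)) :=
  let D := diagram_of p in
  [seq (k_cut D C, ([seq E <- [seq code (q_face D C s) |
       s <- minsides (size D) C] | E != [::]], code (r_cut D C)))
     | C <- subsets D].

Definition code_ok n p :=
  let D := diagram_of p in
  [&& size D == n, dissection D &
  all (fun C => all (fun s => diagram_of (code (q_face D C s)) == q_face D C s)
                    (minsides n C)
             && (diagram_of (code (r_cut D C)) == r_cut D C)) (subsets D)].

(** This is what allows the terms of a coproduct to be named by codes. *)
Fact codes_ok n : (n < 4)%N -> all (code_ok n) (codes n).
Proof. by case: n => [|[|[|[|]]]] // _; vm_compute. Qed.

Lemma mem_subsets (C D : seq chord) : subseq C D -> C \in subsets D.
Proof.
elim: D C => [|d D IHD] [|c C] //=.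
  by move=> _; rewrite mem_cat (IHD [::]) ?orbT // sub0seq.
rewrite mem_cat; case: eqP => [->|_] /IHD CD; last by rewrite CD orbT.
by rewrite map_f.
Qed.

Lemma chord_le_trans : transitive chord_le.
Proof.
move=> [b b'] [a a'] [c c']; rewrite /chord_le /= => ab bc.
by apply/orP; case: (ltngtP a c) => ac; [left|right|right]; move: ab bc ac; lia.
Qed.

Lemma chord_le_anti : antisymmetric chord_le.
Proof.
by move=> [a a'] [b b']; rewrite /chord_le /= => ab; congr (_, _); lia.
Qed.

Definition all_chords n : seq chord :=
  [seq (u, v) | u <- iota 0 n.+1, v <- iota u.+1 (n - u)].

Lemma mem_all_chords n c : (c.1 < c.2)%N -> (c.2 <= n)%N -> c \in all_chords n.
Proof.
case: c => u v /= uv vn; apply/allpairsPdep; exists u, v; rewrite !mem_iota.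
by split=> //; lia.
Qed.

(** The enumeration of diagrams is complete because the chords of a diagram form
    a sorted list without duplicates, which is thus a sublist of the sorted list
    of all chords. *)
Lemma mem_diagrams n D :
  (n < 4)%N -> dissection D -> size D = n -> D \in diagrams n.
Proof.
move=> n4 dD sD; rewrite !mem_filter dD sD eqxx /=; apply: mem_subsets.
rewrite -[subseq _ _]/(subseq D (all_chords n)).
have /andP[sC uC] : sorted chord_le (all_chords n) && uniq (all_chords n).
  by case: n n4 {sD} => [|[|[|[|]]]].
case/and5P: dD => sortD uD /allP bD _ _.
suff -> : D = [seq c <- all_chords n | c \in D] by exact: filter_subseq.
apply: (sorted_eq chord_le_trans chord_le_anti) => //.
  exact: sorted_filter chord_le_trans _ _ sC.
apply: uniq_perm; rewrite ?filter_uniq // => c; rewrite mem_filter.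
apply/idP/andP => [cD|[]//]; split=> //.
by have /andP[c12 c2] := bD c cD; apply: mem_all_chords; rewrite // -sD.
Qed.

Fact diagram_ofK n : (n < 4)%N ->
  {in diagrams n, forall D, diagram_of (code D) = D}.
Proof.
move=> n4; have: all (fun D => diagram_of (code D) == D) (diagrams n).
  by case: n n4 => [|[|[|[|]]]] // _; vm_compute.
by move/allP=> okD D /okD /eqP.
Qed.

Lemma code_diagram n D : (n < 4)%N -> dissection D -> size D = n ->
  exists2 p, p \in codes n & D = diagram_of p.
Proof.
move=> n4 dD sD; have Dn := mem_diagrams n4 dD sD.
by exists (code D); rewrite ?map_f // (diagram_ofK n4 Dn).
Qed.

Lemma codeK n p : (n < 4)%N -> p \in codes n -> code (diagram_of p) = p.
Proof. by move=> n4 /mapP[D DD ->]; rewrite (diagram_ofK n4 DD). Qed.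

(** * The coproduct as a morphism of algebras *)

Section Coproduct.
Variables (K : fieldType) (x : K).
Local Notation L := (@tensl K {cmonom diagram}).
Local Notation R := (@tensr K {cmonom diagram}).

Lemma tensE P Q : tens P Q = L P * R Q.
Proof. by rewrite tensl_tensr. Qed.

Lemma tens1r P : tens P 1 = L P.
Proof. by rewrite tensE; exact: tensl_tensr1. Qed.

Lemma tens1l P : tens 1 P = R P.
Proof. by rewrite tensE; exact: tensl1_tensr. Qed.

Definition coprod : HD K -> HD2 K :=
  ext (fun d : diagram => Delta_gen x (val d)).

HB.instance Definition _ := GRing.RMorphism.on coprod.

Lemma DeltaE P : Delta x P = coprod P.
Proof. by []. Qed.

Lemma coprodZ c P : coprod (c *: P) = c%:A * coprod P.
Proof. exact: extZ. Qed.

Lemma coprod_gen D : dissection D -> (0 < size D)%N ->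
  coprod (gen K D) = Delta_gen x D.
Proof.
move=> dD D0; rewrite /gen; have /negPf-> : D != [::] by case: D D0 {dD}.
case: insubP => [d _ <-|]; last by rewrite dD D0.
exact: ext_ucm.
Qed.

Lemma bracket_nil : bracket K [::] = 1.
Proof. by []. Qed.

Lemma coprod_bracket n p : (0 < n < 4)%N -> p \in codes n ->
  coprod (bracket K p) = \sum_(t <- cut_codes p)
    x%:A ^+ t.1 * (L (\prod_(c <- t.2.1) bracket K c) * R (bracket K t.2.2)).
Proof.
case/andP=> n0 n4 /(allP (codes_ok n4)) /and3P[/eqP sD dD /allP okD].
rewrite coprod_gen ?sD // /Delta_gen /cut_codes big_map.
apply: eq_big_seq => C /okD /andP[/allP okq /eqP okr] /=.
have qE : q_cut K (diagram_of p) C = \prod_(c <- [seq E <- [seq code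
    (q_face (diagram_of p) C s) | s <- minsides (size (diagram_of p)) C]
    | E != [::]]) bracket K c.
  rewrite big_filter big_map /q_cut big_mkcond [RHS]big_mkcond /= sD.
  apply: eq_big_seq => s /okq /eqP oks; rewrite /bracket oks.
  by case: eqP => //= q0; rewrite -oks q0.
by rewrite tensE qE /bracket okr [LHS]scaleX_alg.
Qed.
End Coproduct.

(** * The elements of degree 3 *)

Definition basis3 (H : pzRingType) (br : seq nat -> H) : seq H :=
  [seq br p | p <- codes3] ++ [seq br p * br [:: 0%N] | p <- codes2]
    ++ [:: br [:: 0%N] ^+ 3].

Section Monomials.
Variable K : fieldType.
Local Notation br := (bracket K).
Local Notation a := (br [:: 0]%N).
Implicit Types (m : {cmonom diagram}) (P Q : HD K).

Lemma mon_degreeE (E : {fset diagram}) m : (finsupp m `<=` E)%fset ->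
  mon_degree m = (\sum_(d <- E) m d * size (val d))%N.
Proof.
move=> le; rewrite /mon_degree (big_fset_incl _ le) // => d _.
by rewrite -cmE_neq0 negbK => /eqP->.
Qed.

Lemma mon_degreeM m n : mon_degree (mmul m n) = (mon_degree m + mon_degree n)%N.
Proof.
rewrite {1}/mon_degree mdomD (mon_degreeE (fsubsetUl _ (finsupp n))).
rewrite (mon_degreeE (fsubsetUr (finsupp m) _)) -big_split /=.
by apply: eq_bigr => d _; rewrite cmM mulnDl.
Qed.

Lemma mon_degreeU d : mon_degree (ucm d) = size (val d).
Proof. by rewrite /mon_degree mdomU big_seq_fset1 cmUU mul1n. Qed.

Lemma mon_degree1 : mon_degree mone = 0%N.
Proof. by rewrite /mon_degree mdom1 big_seq_fset0. Qed.

Lemma size_diagram_gt0 (d : diagram) : (0 < size (val d))%N.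
Proof. by case/andP: (valP d). Qed.

Lemma cmonom_split m : m != mone -> exists d n, m = mmul (ucm d) n.
Proof.
have [m1|[d dm] _] := fset_0Vmem (finsupp m).
  case/eqP; apply/eqP/cmP => d; rewrite cm1; apply/eqP.
  by rewrite cmE_eq0 m1 inE.
exists d, (divcm m (ucm d)); apply/eqP/cmP => e.
rewrite cmM divcmE cmU subnKC //; case: eqP => // <-.
by rewrite lt0n cmE_neq0.
Qed.

Lemma mon_degree_eq0 m : mon_degree m = 0%N -> m = mone.
Proof.
have [->//|/cmonom_split[d [n ->]]] := eqVneq m mone.
by rewrite mon_degreeM mon_degreeU; case: (size _) (size_diagram_gt0 d).
Qed.

Lemma gen_val (d : diagram) : gen K (val d) = << ucm d >>.
Proof.
have /negPf d0 : val d != [::] by rewrite -size_eq0 -lt0n size_diagram_gt0.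
by rewrite /gen d0 (valK d).
Qed.

(** Iterating this lemma lists the monomials of a given degree. *)
Lemma degree_split n m : (n < 3)%N -> mon_degree m = n.+1 ->
  exists k p m', [/\ (k <= n)%N, p \in codes k.+1, mon_degree m' = (n - k)%N
    & << m >> = br p * << m' >> :> HD K].
Proof.
move=> n3 mn; have [d [m' mE]]: exists d n, m = mmul (ucm d) n.
  by apply: cmonom_split; apply: contra_eq_neq mn => ->; rewrite mon_degree1.
move: mn; rewrite mE mon_degreeM mon_degreeU => dn.
have := size_diagram_gt0 d; case dk: (size (val d)) dn => [|k] // dn _.
have kn : (k <= n)%N by rewrite -ltnS -dn leq_addr.
have [p pk pE] : exists2 p, p \in codes k.+1 & val d = diagram_of p.
  apply: code_diagram => //; first exact: leq_ltn_trans kn n3.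
  by case/andP: (valP d).
exists k, p, m'; split=> //; last by rewrite -malgUM -gen_val pE.
by rewrite -(addKn k (mon_degree m')); congr subn; case: dn.
Qed.

Lemma monomial3 m : mon_degree m = 3%N -> << m >> \in basis3 br.
Proof.
have aE p : p \in codes 1 -> br p = a by rewrite mem_codes1 mem_seq1 => /eqP->.
have deg1 n : mon_degree n = 1%N -> << n >> = a.
  case/(@degree_split 0 n isT)=> k [p [m' [k0 pk /mon_degree_eq0-> ->]]].
  by move: k0 pk; rewrite leqn0 => /eqP-> /aE->; rewrite mulr1.
have deg2 n : mon_degree n = 2%N ->
    << n >> = a * a \/ exists2 p, p \in codes2 & << n >> = br p.
  case/(@degree_split 1 n isT)=> k [p [m' [k1 pk m'E ->]]].
  case: k k1 pk m'E => [|[|//]] _ pk m'E.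
    by left; rewrite (aE p pk) (deg1 m' m'E).
  by right; exists p; rewrite -?mem_codes2 // (mon_degree_eq0 m'E) mulr1.
case/(@degree_split 2 m isT)=> k [p [m' [k2 pk m'E ->]]].
rewrite /basis3 !mem_cat.
case: k k2 pk m'E => [|[|[|//]]] _ pk m'E.
- rewrite (aE p pk); case: (deg2 m' m'E) => [->|[q q2 ->]].
    by rewrite mulrA -expr2 -exprSr mem_seq1 eqxx !orbT.
  by rewrite mulrC (map_f (fun q => br q * a)) // orbT.
- by rewrite (deg1 m' m'E) (map_f (fun q => br q * a)) ?orbT // -mem_codes2.
- by rewrite (mon_degree_eq0 m'E) mulr1 map_f // -mem_codes3.
Qed.

Lemma homogeneous3_span P : homogeneous 3 P ->
  exists c : nat -> K, P = \sum_(i < size (basis3 br)) c i *: (basis3 br)`_i.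
Proof.
move=> hP; rewrite [P]monalgE.
under eq_bigr do rewrite malgU_scale.
by apply: lincomb_seq => m /hP /monomial3.
Qed.

Lemma homogeneousD n P Q :
  homogeneous n P -> homogeneous n Q -> homogeneous n (P + Q).
Proof.
move=> hP hQ m /(fsubsetP (msuppD_le _ _)); rewrite in_fsetU.
by case/orP=> [/hP|/hQ].
Qed.

Lemma homogeneousN n P : homogeneous n P -> homogeneous n (- P).
Proof. by move=> hP m; rewrite msuppN => /hP. Qed.

Lemma homogeneousZ n c P : homogeneous n P -> homogeneous n (c *: P).
Proof. by move=> hP m /(fsubsetP (msuppZ_le _ _)) /hP. Qed.

Lemma homogeneousM n k P Q :
  homogeneous n P -> homogeneous k Q -> homogeneous (n + k) (P * Q).
Proof.
move=> hP hQ m /msuppM_le[m1 [m2 [/hP<- /hQ<- ->]]].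
exact: mon_degreeM.
Qed.

Lemma code_ucm n p : (n < 3)%N -> p \in codes n.+1 ->
  exists2 d : diagram, val d = diagram_of p & br p = << ucm d >>.
Proof.
move=> n3 pn; have /allP/(_ p pn)/and3P[/eqP sp dp _] := @codes_ok n.+1 n3.
have pP : dissection (diagram_of p) && (0 < size (diagram_of p))%N.
  by rewrite dp sp.
by exists (Sub (diagram_of p) pP); rewrite -?gen_val SubK.
Qed.

Lemma homogeneous_br n p :
  (n < 3)%N -> p \in codes n.+1 -> homogeneous n.+1 (br p).
Proof.
move=> n3 pn m; have [d dp ->] := code_ucm n3 pn.
rewrite msuppU1 in_fset1 => /eqP->; rewrite mon_degreeU dp.
by have /allP/(_ p pn)/and3P[/eqP] := @codes_ok n.+1 n3.
Qed.

Lemma homogeneous_basis3 P : P \in basis3 br -> homogeneous 3 P.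
Proof.
have ha : homogeneous 1 a by apply: homogeneous_br; rewrite ?mem_codes1.
rewrite /basis3 !mem_cat => /or3P[/mapP[p p3 ->]|/mapP[p p2 ->]|].
- by apply: homogeneous_br; rewrite ?mem_codes3.
- apply: (@homogeneousM 2 1) => //.
  by apply: homogeneous_br; rewrite ?mem_codes2.
rewrite mem_seq1 => /eqP->; rewrite exprS expr2.
by apply: (@homogeneousM 1 2) => //; apply: (@homogeneousM 1 1).
Qed.

(** The coefficient of the diagram [p_1, ..., p_n]; the value 0 on lists that
    are not the code of a diagram makes it a total function of p. *)
Definition dcoef (p : seq nat) P : K :=
  if insub (diagram_of p) is Some d then P@_(ucm (d : diagram)) else 0.

Lemma dcoefE p (d : diagram) P :
  val d = diagram_of p -> dcoef p P = P@_(ucm d).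
Proof. by move=> dp; rewrite /dcoef -dp valK. Qed.

Lemma dcoefD p P Q : dcoef p (P + Q) = dcoef p P + dcoef p Q.
Proof. by rewrite /dcoef; case: insub => [d|]; rewrite ?mcoeffD ?addr0. Qed.

Lemma dcoefN p P : dcoef p (- P) = - dcoef p P.
Proof. by rewrite /dcoef; case: insub => [d|]; rewrite ?mcoeffN ?oppr0. Qed.

Lemma dcoefZ p c P : dcoef p (c *: P) = c * dcoef p P.
Proof. by rewrite /dcoef; case: insub => [d|]; rewrite ?mcoeffZ ?mulr0. Qed.

(** A single diagram is not a product of two monomials other than 1. *)
Lemma dcoef_mul p P Q : P@_mone = 0 -> Q@_mone = 0 -> dcoef p (P * Q) = 0.
Proof.
move=> P0 Q0; rewrite /dcoef; case: insub => // d.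
apply/eqP; rewrite mcoeff_eq0; apply/negP => /msuppM_le[m [n [mP nQ dE]]].
have: (mdeg m + mdeg n = 1)%N by rewrite -mdegM -dE mdegU.
have mdeg0 (k : {cmonom diagram}) : mdeg k = 0%N -> k = mone.
  exact: mdeg_eq0I.
case dm: (mdeg m) => [|[|//]]; last first.
  by case=> /mdeg0 n1; move: nQ; rewrite n1 -mcoeff_neq0 Q0 eqxx.
by move: mP; rewrite (mdeg0 _ dm) -mcoeff_neq0 P0 eqxx.
Qed.

Lemma br_counit n p : (n < 3)%N -> p \in codes n.+1 -> (br p)@_mone = 0.
Proof.
by move=> n3 /(code_ucm n3)[d _ ->]; rewrite mcoeffU1 cm1_eq1.
Qed.

Lemma dcoef_br n k p q :
    (n < 3)%N -> (k < 3)%N -> p \in codes n.+1 -> q \in codes k.+1 ->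
  dcoef p (br q) = (p == q)%:R.
Proof.
move=> n3 k3 pn qk; have [d dp _] := code_ucm n3 pn.
have [e eq ->] := code_ucm k3 qk.
rewrite (dcoefE _ dp) mcoeffU1; congr (_%:R); congr nat_of_bool.
transitivity (d == e).
  by apply/eqP/eqP => [|->//] /eqP/cmP/(_ e); rewrite !cmU eqxx; case: eqP.
rewrite -val_eqE /= dp eq; apply/eqP/eqP => [pq|->//].
by rewrite -(@codeK n.+1 p) // pq (@codeK k.+1 q).
Qed.
End Monomials.

(** * The matrix of the reduced coproduct *)

(** An algebra H, with maps L, R, cop and a family br, that behaves like H_D
    with P |-> P (x) 1, P |-> 1 (x) P, Delta and the brackets. The algebra A
    plays the role of the tensor square; its structure over K is the morphism s,
    so that every identity in A is one of commutative rings. *)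
Section DegreeThree.
Variables (K : fieldType) (x : K) (H : comAlgType K) (A : comNzRingType).
Variables (s : {rmorphism K -> A}) (L R cop : {rmorphism H -> A}).
Variable br : seq nat -> H.
Hypotheses (LZ : forall c P, L (c *: P) = s c * L P)
  (RZ : forall c P, R (c *: P) = s c * R P)
  (copZ : forall c P, cop (c *: P) = s c * cop P).
Hypothesis br_nil : br [::] = 1.
Hypothesis cop_br : forall n p, (0 < n < 4)%N -> p \in codes n ->
  cop (br p) = \sum_(t <- cut_codes p)
    s x ^+ t.1 * (L (\prod_(c <- t.2.1) br c) * R (br t.2.2)).

(** eps is the counit, and dc p the coefficient of the diagram of code p; the
    latter vanishes on products of elements of the augmentation ideal. *)
Variables (eps : {rmorphism H -> K}) (dc : seq nat -> H -> K).
Hypotheses (dcD : forall p P Q, dc p (P + Q) = dc p P + dc p Q)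
  (dcN : forall p P, dc p (- P) = - dc p P)
  (dcZ : forall p c P, dc p (c *: P) = c * dc p P)
  (dcM : forall p P Q, eps P = 0 -> eps Q = 0 -> dc p (P * Q) = 0).
Hypotheses
  (eps_br : forall n p, (n < 3)%N -> p \in codes n.+1 -> eps (br p) = 0)
  (dc_br : forall n k p q, (n < 3)%N -> (k < 3)%N ->
     p \in codes n.+1 -> q \in codes k.+1 -> dc p (br q) = (p == q)%:R).

Local Notation a := (br [:: 0]%N).
Local Notation Y := (br [:: 2; 0]%N).
Local Notation X := (br [:: 0; 0]%N).
Local Notation W := (br [:: 0; 1]%N).

(** The reduced coproduct. *)
Definition reduced P := cop P - (L P + R P).
(** The element P (x) a + a (x) Q. *)
Definition mixed P Q := L P * R a + L a * R Q.

Ltac cuts n p :=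
  rewrite (@cop_br n p); [|by []|by vm_compute];
  let t := eval vm_compute in (cut_codes p) in
  rewrite (_ : cut_codes p = t); [|by vm_compute];
  rewrite !big_cons !big_nil br_nil /=.

Lemma reducedD P Q : reduced (P + Q) = reduced P + reduced Q.
Proof. by rewrite /reduced !rmorphD; ring. Qed.

Lemma reducedN P : reduced (- P) = - reduced P.
Proof. by rewrite /reduced !rmorphN; ring. Qed.

Lemma reducedZ c P : reduced (c *: P) = s c * reduced P.
Proof. by rewrite /reduced LZ RZ copZ; ring. Qed.

Lemma cop_a : cop a = L a + R a.
Proof. cuts 1%N [:: 0]%N. ring. Qed.
Lemma cop_X : cop X = L X + R X + 2 * L a * R a.
Proof. cuts 2%N [:: 0; 0]%N. ring. Qed.
Lemma cop_Y : cop Y = L Y + R Y + 2 * L a * R a.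
Proof. cuts 2%N [:: 2; 0]%N. ring. Qed.
Lemma cop_W : cop W = L W + R W + (1 + s x) * L a * R a.
Proof. cuts 2%N [:: 0; 1]%N. ring. Qed.

Ltac expand := rewrite ?(rmorphD, rmorphB, LZ, RZ).
Ltac red3 p := rewrite /reduced /mixed; cuts 3%N p; expand; ring.

Lemma reduced_010 : reduced (br [:: 0; 1; 0]%N)
  = mixed ((1 + x) *: X + W) (X + W + x *: Y).
Proof. red3 [:: 0; 1; 0]%N. Qed.
Lemma reduced_200 : reduced (br [:: 2; 0; 0]%N)
  = mixed (a ^+ 2 + Y + X) (X + 2 *: Y).
Proof. red3 [:: 2; 0; 0]%N. Qed.
Lemma reduced_002 : reduced (br [:: 0; 0; 2]%N)
  = mixed (W + a ^+ 2 + x *: X) ((1 + x) *: X + W).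
Proof. red3 [:: 0; 0; 2]%N. Qed.
Lemma reduced_012 : reduced (br [:: 0; 1; 2]%N)
  = mixed ((1 + 2 * x) *: W) (W + x *: X + x ^+ 2 *: Y).
Proof. red3 [:: 0; 1; 2]%N. Qed.
Lemma reduced_011 : reduced (br [:: 0; 1; 1]%N)
  = mixed (X + x *: W + x *: a ^+ 2) ((2 + x) *: W).
Proof. red3 [:: 0; 1; 1]%N. Qed.
Lemma reduced_000 : reduced (br [:: 0; 0; 0]%N)
  = mixed (2 *: X + a ^+ 2) (3 *: X).
Proof. red3 [:: 0; 0; 0]%N. Qed.
Lemma reduced_202 : reduced (br [:: 2; 0; 2]%N)
  = mixed (a ^+ 2 + W + x *: Y) ((1 + x) *: Y + W).
Proof. red3 [:: 2; 0; 2]%N. Qed.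
Lemma reduced_330 : reduced (br [:: 3; 3; 0]%N)
  = mixed (X + a ^+ 2 + Y) (2 *: Y + X).
Proof. red3 [:: 3; 3; 0]%N. Qed.
Lemma reduced_031 : reduced (br [:: 0; 3; 1]%N)
  = mixed (Y + x *: a ^+ 2 + W) (W + (1 + x) *: X).
Proof. red3 [:: 0; 3; 1]%N. Qed.
Lemma reduced_310 : reduced (br [:: 3; 1; 0]%N)
  = mixed (W + x *: Y + a ^+ 2) ((1 + x) *: Y + W).
Proof. red3 [:: 3; 1; 0]%N. Qed.
Lemma reduced_030 : reduced (br [:: 0; 3; 0]%N)
  = mixed (Y + 2 *: X) (2 *: X + Y).
Proof. red3 [:: 0; 3; 0]%N. Qed.
Lemma reduced_230 : reduced (br [:: 2; 3; 0]%N)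
  = mixed (3 *: Y) (3 *: Y).
Proof. red3 [:: 2; 3; 0]%N. Qed.

Ltac redmul := rewrite /reduced /mixed !rmorphM ?(cop_W, cop_X, cop_Y) cop_a;
  expand; ring.
Lemma reduced_Wa : reduced (W * a)
  = mixed (W + (1 + x) *: a ^+ 2) (W + (1 + x) *: a ^+ 2).
Proof. redmul. Qed.
Lemma reduced_Xa : reduced (X * a)
  = mixed (X + 2 *: a ^+ 2) (X + 2 *: a ^+ 2).
Proof. redmul. Qed.
Lemma reduced_Ya : reduced (Y * a)
  = mixed (Y + 2 *: a ^+ 2) (Y + 2 *: a ^+ 2).
Proof. redmul. Qed.
Lemma reduced_a3 : reduced (a ^+ 3)
  = mixed (3 *: a ^+ 2) (3 *: a ^+ 2).
Proof. by rewrite /reduced /mixed !rmorphXn cop_a; expand; ring. Qed.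

Definition reducedE := (reduced_010, reduced_200, reduced_002, reduced_012,
  reduced_011, reduced_000, reduced_202, reduced_330, reduced_031, reduced_310,
  reduced_030, reduced_230, reduced_Wa, reduced_Xa, reduced_Ya, reduced_a3).

(** * The nine elements are primitive *)

Let V1 := br [:: 0; 1; 0]%N - x *: br [:: 2; 0; 0]%N
    + x *: br [:: 0; 0; 2]%N - (1 + x) *: (W * a)
    - (1 + x ^+ 2) *: (X * a) + x *: (Y * a) + (x ^+ 2 + 1) *: a ^+ 3.
Let V2 := br [:: 0; 1; 2]%N - x ^+ 2 *: br [:: 2; 0; 0]%N
    + x *: br [:: 0; 1; 1]%N - (1 + x) ^+ 2 *: (W * a)
    + (x * (x - 1)) *: (X * a) + x ^+ 2 *: (Y * a)
    + ((x ^+ 3 - x ^+ 2 + 5 * x + 1) / 3) *: a ^+ 3.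
Let V3 := br [:: 0; 0; 2]%N - br [:: 0; 0; 0]%N - W * a
    - (x - 2) *: (X * a) + (x - 1) *: a ^+ 3.
Let V4 := br [:: 2; 0; 2]%N - br [:: 3; 3; 0]%N - W * a + X * a
    - (x - 1) *: (Y * a) + (x - 1) *: a ^+ 3.
Let V5 := br [:: 0; 3; 1]%N - (1 + x) *: br [:: 0; 0; 0]%N
    + br [:: 2; 0; 2]%N - 2 *: (W * a) + (2 * (1 + x)) *: (X * a)
    - (1 + x) *: (Y * a).
Let V6 := br [:: 3; 1; 0]%N - br [:: 2; 0; 2]%N.
Let V7 := br [:: 2; 0; 0]%N - br [:: 3; 1; 0]%N + W * a - X * a
    + (x - 1) *: (Y * a) - (x - 1) *: a ^+ 3.
Let V8 := br [:: 0; 3; 0]%N - 2 *: (X * a) - Y * a + 2 *: a ^+ 3.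
Let V9 := br [:: 2; 3; 0]%N - 3 *: (Y * a) + 2 *: a ^+ 3.

Ltac redV :=
  rewrite !(reducedD, reducedN, reducedZ) !reducedE /mixed; expand; ring.

Lemma reduced_V1 : reduced V1 = 0. Proof. rewrite /V1; redV. Qed.
Lemma reduced_V3 : reduced V3 = 0. Proof. rewrite /V3; redV. Qed.
Lemma reduced_V4 : reduced V4 = 0. Proof. rewrite /V4; redV. Qed.
Lemma reduced_V5 : reduced V5 = 0. Proof. rewrite /V5; redV. Qed.
Lemma reduced_V6 : reduced V6 = 0. Proof. rewrite /V6; redV. Qed.
Lemma reduced_V7 : reduced V7 = 0. Proof. rewrite /V7; redV. Qed.
Lemma reduced_V8 : reduced V8 = 0. Proof. rewrite /V8; redV. Qed.
Lemma reduced_V9 : reduced V9 = 0. Proof. rewrite /V9; redV. Qed.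

(** Only the coefficient of a^3 in V2 is a fraction. Since the reduced coproduct
    of a^3 is 3 (a^2 (x) a + a (x) a^2), three times this coefficient, which is
    the polynomial q in x, is all that occurs. *)
Lemma reduced_V2 : (3 : K) != 0 -> reduced V2 = 0.
Proof.
move=> n3; rewrite /V2; set c := _ / 3; set q := x ^+ 3 - _ + _ + _ in c *.
have cE : s (c * 3) = s q by rewrite divfK.
rewrite !(reducedD, reducedN, reducedZ) !reducedE /mixed; expand.
transitivity ((s (c * 3) - s q) * (L (a ^+ 2) * R a + L a * R (a ^+ 2))).
  by rewrite /q; ring.
by rewrite cE subrr mul0r.
Qed.

(** * Primitive elements that vanish on the pivots *)

(** The rows of the matrix at the seven monomials that are not pivots. *)
Lemma reduced_residual u v t w' p q r :
  reduced (u *: br [:: 0; 1; 1]%N + v *: br [:: 0; 0; 0]%N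
     + t *: br [:: 2; 0; 2]%N + w' *: (W * a) + p *: (X * a) + q *: (Y * a)
     + r *: a ^+ 3)
  = mixed ((u + 2 * v + p) *: X + (x * u + t + w') *: W + (x * t + q) *: Y
           + (x * u + v + t + (1 + x) * w' + 2 * p + 2 * q + 3 * r) *: a ^+ 2)
      ((3 * v + p) *: X + ((2 + x) * u + t + w') *: W + ((1 + x) * t + q) *: Y
           + ((1 + x) * w' + 2 * p + 2 * q + 3 * r) *: a ^+ 2).
Proof. by rewrite !(reducedD, reducedZ) !reducedE /mixed; expand; ring. Qed.

Lemma eps_code p : p \in codes1 ++ codes2 -> eps (br p) = 0.
Proof. by rewrite mem_cat -mem_codes1 -mem_codes2 => /orP[]; apply: eps_br. Qed.

Lemma dc_mul_a p q : q \in codes2 -> dc p (br q * a) = 0.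
Proof. by move=> q2; rewrite dcM // eps_code // mem_cat q2 orbT. Qed.

Lemma dc_a2 p : dc p (a ^+ 2) = 0.
Proof. by rewrite expr2 dcM // eps_code. Qed.

Lemma dc_a3 p : dc p (a ^+ 3) = 0.
Proof.
have a0 : eps a = 0 by exact: eps_code.
by rewrite exprS dcM // rmorphXn a0 expr0n.
Qed.

Lemma dc_br2 k p q : (k < 3)%N -> p \in codes k.+1 -> q \in codes2 ->
  dc p (br q) = (p == q)%:R.
Proof. by move=> k3 pk q2; rewrite (@dc_br k 1) // mem_codes2. Qed.

Lemma dc_br3 p q : p \in codes3 -> q \in codes3 -> dc p (br q) = (p == q)%:R.
Proof. by move=> p3 q3; rewrite (@dc_br 2 2) // mem_codes3. Qed.

Lemma dc_deg2 k p u v w t : (k < 3)%N -> p \in codes k.+1 ->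
  dc p (u *: X + v *: W + w *: Y + t *: a ^+ 2)
  = u * (p == [:: 0; 0]%N)%:R + v * (p == [:: 0; 1]%N)%:R
    + w * (p == [:: 2; 0]%N)%:R.
Proof.
by move=> k3 pk; rewrite !(dcD, dcZ) dc_a2 !(dc_br2 k3 pk) // mulr0 addr0.
Qed.

(** This is the linear independence of the tensors m (x) a and a (x) m, for the
    monomials m other than a. *)
Hypothesis mixed_eq0 : forall P Q, dc [:: 0]%N P = 0 -> dc [:: 0]%N Q = 0 ->
  mixed P Q = 0 -> P = 0 /\ Q = 0.
Hypothesis a2_free : forall t, t *: a ^+ 2 = 0 -> t = 0.

Lemma dc0 p : dc p 0 = 0.
Proof. by rewrite -(scale0r (0 : H)) dcZ mul0r. Qed.

Lemma deg2_free u v w t : u *: X + v *: W + w *: Y + t *: a ^+ 2 = 0 ->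
  [/\ u = 0, v = 0, w = 0 & t = 0].
Proof.
move=> E.
have cE p : p \in codes2 -> u * (p == [:: 0; 0]%N)%:R
    + v * (p == [:: 0; 1]%N)%:R + w * (p == [:: 2; 0]%N)%:R = 0.
  by move=> p2; rewrite -(@dc_deg2 1 p _ _ _ t) ?E ?dc0 // mem_codes2.
have u0 : u = 0 by have := cE [:: 0; 0]%N isT; rewrite /= !mulr0 mulr1 !addr0.
have v0 : v = 0.
  by have := cE [:: 0; 1]%N isT; rewrite /= !mulr0 mulr1 addr0 add0r.
have w0 : w = 0 by have := cE [:: 2; 0]%N isT; rewrite /= !mulr0 mulr1 !add0r.
by split=> //; apply: a2_free; rewrite -E u0 v0 w0 !scale0r !add0r.
Qed.

Hypotheses (n2 : (2 : K) != 0) (n3 : (3 : K) != 0).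

(** Eight equations in seven unknowns: e1, ..., e4 come from the coefficients of
    X, W, Y and a^2 in the part A (x) a, and f1, ..., f4 from those in the part
    a (x) B. The difference of f3 and e3 is t, that of f2 and e2 is 2 u, and
    that of e1 and f1 is then - v. *)
Lemma residual_eq0 u v t w p q r :
  reduced (u *: br [:: 0; 1; 1]%N + v *: br [:: 0; 0; 0]%N
     + t *: br [:: 2; 0; 2]%N + w *: (W * a) + p *: (X * a) + q *: (Y * a)
     + r *: a ^+ 3) = 0 ->
  [/\ [/\ u = 0, v = 0, t = 0 & w = 0], p = 0, q = 0 & r = 0].
Proof.
rewrite reduced_residual.
have ca u' v' w' t' : dc [:: 0]%N
    (u' *: X + v' *: W + w' *: Y + t' *: a ^+ 2) = 0.
  by rewrite (@dc_deg2 0) ?mem_codes1 //= !mulr0 !addr0.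
case/mixed_eq0 => // /deg2_free[e1 e2 e3 e4] /deg2_free[f1 f2 f3 f4].
have t0 : t = 0 by rewrite -[RHS](subrr 0) -{1}f3 -e3; ring.
have q0 : q = 0 by rewrite t0 mulr0 add0r in e3.
have u0 : u = 0.
  apply: (mulfI n2); rewrite mulr0 -[RHS](subrr 0) -{1}f2 -e2; ring.
have v0 : v = 0 by rewrite -[RHS](subrr 0) -{1}f1 -e1 u0; ring.
have p0 : p = 0 by rewrite v0 mulr0 add0r in f1.
have w0 : w = 0 by rewrite u0 t0 mulr0 !add0r in e2.
rewrite w0 p0 q0 !mulr0 !add0r in f4.
by split=> //; apply: (mulfI n3); rewrite f4 mulr0.
Qed.

(** hom P stands for P being homogeneous of degree 3. *)
Variable hom : H -> Prop.
Hypotheses (homD : forall P Q, hom P -> hom Q -> hom (P + Q))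
  (homN : forall P, hom P -> hom (- P))
  (homZ : forall c P, hom P -> hom (c *: P))
  (hom_basis : forall P, P \in basis3 br -> hom P)
  (hom_span : forall P, hom P -> exists c : nat -> K,
     P = \sum_(i < size (basis3 br)) c i *: (basis3 br)`_i).

Lemma dc_basis3 i j : (i < size (basis3 br))%N -> (j < 12)%N ->
  dc (nth [::] codes3 j) (basis3 br)`_i = (i == j)%:R.
Proof.
move=> i16 j12; have jP : nth [::] codes3 j \in codes3 by rewrite mem_nth.
rewrite nth_cat size_map; case: ltnP => i12.
  by rewrite (nth_map [::]) // dc_br3 ?mem_nth // nth_uniq // eq_sym.
rewrite gtn_eqF ?(leq_trans j12) // nth_cat size_map; case: ltnP => i15.
  by rewrite (nth_map [::]) // dc_mul_a ?mem_nth.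
by case: (_ - _)%N => [|k]; rewrite /= ?nth_nil ?dc_a3 ?dc0.
Qed.

(** On an element vanishing at the pivots only the seven monomials of
    [residual_eq0] are left. *)
Lemma pivots_injective P : hom P -> reduced P = 0 ->
  [seq dc p P | p <- take 9 codes3] = nseq 9 0 -> P = 0.
Proof.
case/hom_span=> c ->; set S := \sum_(i < _) _ => rS.
have cE j : (j < 12)%N -> dc (nth [::] codes3 j) S = c j.
  move=> j12; rewrite (big_morph _ (dcD _) (dc0 _)).
  have j16 : (j < size (basis3 br))%N by apply: leq_trans j12 _.
  rewrite (bigD1 (Ordinal j16)) //= dcZ dc_basis3 // eqxx mulr1.
  rewrite big1 ?addr0 // => i /negPf ij.
  by rewrite dcZ dc_basis3 // -val_eqE /= in ij *; rewrite ij mulr0.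
case; rewrite (cE 0%N) // (cE 1%N) // (cE 2) // (cE 3) // (cE 4) // (cE 5) //.
rewrite (cE 6) // (cE 7) // (cE 8) // => c0 c1 c2 c3 c4 c5 c6 c7 c8.
move: rS; rewrite /S !big_ord_recl big_ord0 /= /bump !leq0n !add1n.
rewrite c0 c1 c2 c3 c4 c5 c6 c7 c8 !scale0r !add0r addr0 !addrA.
move=> /residual_eq0[[-> -> -> ->] -> -> ->].
by rewrite !scale0r !addr0.
Qed.

(** * The coordinates of the nine elements on the pivots *)

Definition Vs := [tuple V1; V2; V3; V4; V5; V6; V7; V8; V9].

Ltac dcV p3 :=
  rewrite ?(dcD, dcN, dcZ) ?dc_mul_a // ?dc_a3 !(dc_br3 p3) //; ring.

Lemma dc_V1 p : p \in codes3 -> dc p V1 =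
  (p == [:: 0; 1; 0]%N)%:R - x * (p == [:: 2; 0; 0]%N)%:R
    + x * (p == [:: 0; 0; 2]%N)%:R.
Proof. by move=> p3; rewrite /V1; dcV p3. Qed.
Lemma dc_V2 p : p \in codes3 -> dc p V2 =
  (p == [:: 0; 1; 2]%N)%:R - x ^+ 2 * (p == [:: 2; 0; 0]%N)%:R
    + x * (p == [:: 0; 1; 1]%N)%:R.
Proof. by move=> p3; rewrite /V2; dcV p3. Qed.
Lemma dc_V3 p : p \in codes3 -> dc p V3 =
  (p == [:: 0; 0; 2]%N)%:R - (p == [:: 0; 0; 0]%N)%:R.
Proof. by move=> p3; rewrite /V3; dcV p3. Qed.
Lemma dc_V4 p : p \in codes3 -> dc p V4 =
  (p == [:: 2; 0; 2]%N)%:R - (p == [:: 3; 3; 0]%N)%:R.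
Proof. by move=> p3; rewrite /V4; dcV p3. Qed.
Lemma dc_V5 p : p \in codes3 -> dc p V5 =
  (p == [:: 0; 3; 1]%N)%:R - (1 + x) * (p == [:: 0; 0; 0]%N)%:R
    + (p == [:: 2; 0; 2]%N)%:R.
Proof. by move=> p3; rewrite /V5; dcV p3. Qed.
Lemma dc_V6 p : p \in codes3 -> dc p V6 =
  (p == [:: 3; 1; 0]%N)%:R - (p == [:: 2; 0; 2]%N)%:R.
Proof. by move=> p3; rewrite /V6; dcV p3. Qed.
Lemma dc_V7 p : p \in codes3 -> dc p V7 =
  (p == [:: 2; 0; 0]%N)%:R - (p == [:: 3; 1; 0]%N)%:R.
Proof. by move=> p3; rewrite /V7; dcV p3. Qed.
Lemma dc_V8 p : p \in codes3 -> dc p V8 =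
  (p == [:: 0; 3; 0]%N)%:R.
Proof. by move=> p3; rewrite /V8; dcV p3. Qed.
Lemma dc_V9 p : p \in codes3 -> dc p V9 =
  (p == [:: 2; 3; 0]%N)%:R.
Proof. by move=> p3; rewrite /V9; dcV p3. Qed.

(** The coordinates on the pivots. This system of nine equations is triangular
    in the order c 0, c 1, c 3, c 4, c 7, c 8, c 2, c 6, c 5. *)
Lemma dc_combination (c : nat -> K) :
  [seq dc p (\sum_(i < 9) c i *: tnth Vs i) | p <- take 9 codes3] =
  [:: c 0%N; c 1%N; c 2 + x * c 0%N; - c 3; c 4; c 5 - c 6;
      c 6 - x * c 0%N - x ^+ 2 * c 1%N; c 7; c 8].
Proof.
have dcE : {in take 9 codes3,
    (fun p => dc p (\sum_(i < 9) c i *: tnth Vs i)) =1 fun p =>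
    c 0%N * dc p V1 + c 1%N * dc p V2 + c 2 * dc p V3 + c 3 * dc p V4
    + c 4 * dc p V5 + c 5 * dc p V6 + c 6 * dc p V7 + c 7 * dc p V8
    + c 8 * dc p V9}.
  move=> p p3; rewrite !big_ord_recl big_ord0 !(tnth_nth 0) /=.
  by rewrite !(dcD, dcZ) dc0; ring.
move/eq_in_map: dcE => ->.
rewrite /= !(dc_V1, dc_V2, dc_V3, dc_V4, dc_V5, dc_V6, dc_V7, dc_V8) //=.
rewrite !dc_V9 //=.
by congr [:: _; _; _; _; _; _; _; _; _]; ring.
Qed.

(** * The basis property *)

Lemma hom_V i : hom (tnth Vs i).
Proof.
have h p : p \in codes3 -> hom (br p).
  by move=> p3; apply: hom_basis; rewrite mem_cat map_f.
have h2 p : p \in codes2 -> hom (br p * a).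
  move=> p2; apply: hom_basis; rewrite !mem_cat.
  by rewrite (map_f (fun p => br p * a)) ?orbT.
have ha3 : hom (a ^+ 3).
  by apply: hom_basis; rewrite !mem_cat mem_seq1 eqxx !orbT.
rewrite (tnth_nth 0); case: i => [[|[|[|[|[|[|[|[|[|//]]]]]]]]] /= _].
all: rewrite ?/V1 ?/V2 ?/V3 ?/V4 ?/V5 ?/V6 ?/V7 ?/V8 ?/V9.
all: repeat (apply: homD || apply: homN || apply: homZ).
all: first [exact: ha3 | exact: h | exact: h2].
Qed.

Lemma reduced_V i : reduced (tnth Vs i) = 0.
Proof.
rewrite (tnth_nth 0); case: i => [[|[|[|[|[|[|[|[|[|//]]]]]]]]] /= _].
- exact: reduced_V1.
- exact: reduced_V2.
- exact: reduced_V3.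
- exact: reduced_V4.
- exact: reduced_V5.
- exact: reduced_V6.
- exact: reduced_V7.
- exact: reduced_V8.
- exact: reduced_V9.
Qed.

Lemma hom_reduced_basis : is_basis (fun P => hom P /\ reduced P = 0) (tnth Vs).
Proof.
have homS c : hom (\sum_(i < 9) c i *: tnth Vs i).
  have h0 : hom 0 by rewrite -(scale0r (tnth Vs ord0)); apply/homZ/hom_V.
  elim/big_ind: _ => [//|P Q hP hQ|i _]; first exact: homD.
  exact/homZ/hom_V.
have reducedS c : reduced (\sum_(i < 9) c i *: tnth Vs i) = 0.
  elim/big_ind: _ => [|P Q hP hQ|i _]; last by rewrite reducedZ reduced_V mulr0.
    by rewrite -(scale0r (0 : H)) reducedZ rmorph0 mul0r.
  by rewrite reducedD hP hQ addr0.
have ordE (F : 'I_9 -> K) : exists c : nat -> K, F =1 c.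
  by exists (fun k => F (inord k)) => i; rewrite inord_val.
split=> [i|F|w [hw rw]]; first by split; [apply: hom_V|apply: reduced_V].
- have [c Fc] := ordE F.
  under eq_bigr do rewrite Fc.
  move=> S0; have := dc_combination c; rewrite S0 /= !dc0.
  case=> c0 c1 c2 c3 c4 c5 c6 c7 c8.
  have d2 : c 2 = 0 by rewrite c2 -c0 mulr0 addr0.
  have d3 : c 3 = 0 by apply/eqP; rewrite -oppr_eq0 -c3.
  have d6 : c 6 = 0 by rewrite c6 -c0 -c1 !mulr0 !subr0.
  have d5 : c 5 = 0 by rewrite c5 d6 subr0.
  by move=> i; rewrite Fc; case: i => [[|[|[|[|[|[|[|[|[|//]]]]]]]]] /=].
(* The coordinates of w on the pivots, and the solution of the triangular
   system that they define. *)
pose d (k : nat) := dc (nth [::] codes3 k) w.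
pose c (k : nat) : K := nth 0 [:: d 0%N; d 1%N; d 2 - x * d 0%N; - d 3; d 4;
  d 5 + (d 6 + x * d 0%N + x ^+ 2 * d 1%N);
  d 6 + x * d 0%N + x ^+ 2 * d 1%N; d 7; d 8] k.
exists (fun i => c i); apply/eqP; rewrite -subr_eq0; apply/eqP.
apply: pivots_injective.
- by apply: homD => //; apply: homN.
- by rewrite reducedD reducedN rw reducedS oppr0 addr0.
have := dc_combination c; rewrite /c /=.
case=> c0 c1 c2 c3 c4 c5 c6 c7 c8.
rewrite !dcD !dcN c0 c1 c2 c3 c4 c5 c6 c7 c8 /d /=.
congr [:: _; _; _; _; _; _; _; _; _]; ring.
Qed.
End DegreeThree.

(** * The Hopf algebra of dissection diagrams *)

Section Dissection.
Variables (K : fieldType) (x : K).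
Local Notation br := (bracket K).
Local Notation a := (br [:: 0]%N).
Local Notation L := (@tensl K {cmonom diagram}).
Local Notation R := (@tensr K {cmonom diagram}).

Fact code_a : [:: 0]%N \in codes 1.
Proof. by rewrite mem_codes1. Qed.

(** The coefficients at (m, a) and at (a, m) determine P and Q, once a itself is
    excluded from both. *)
Lemma mixed_eq0 P Q : dcoef [:: 0]%N P = 0 -> dcoef [:: 0]%N Q = 0 ->
  mixed L R br P Q = 0 -> P = 0 /\ Q = 0.
Proof.
have [d dE aE] := @code_ucm K 0 _ isT code_a.
rewrite !(dcoefE _ dE) => Pa Qa PQ.
have PQE m n : P@_m * a@_n + a@_m * Q@_n = 0.
  by rewrite -!mcoeff_tensl_tensr -mcoeffD [_ + _]PQ mcoeff0.
have aa : a@_(ucm d) = 1 by rewrite aE mcoeffUU.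
split; apply/malgP => m; rewrite mcoeff0.
- by have := PQE m (ucm d); rewrite aa mulr1 Qa mulr0 addr0.
- by have := PQE (ucm d) m; rewrite aa mul1r Pa mul0r add0r.
Qed.

Lemma a2_free (t : K) : t *: a ^+ 2 = 0 -> t = 0.
Proof.
have [d _ ->] := @code_ucm K 0 _ isT code_a.
rewrite expr2 malgUM => /(congr1 (mcoeff (mmul (ucm d) (ucm d)))).
by rewrite mcoeffZ mcoeffUU mulr1 mcoeff0.
Qed.

Lemma primitiveE P : primitive x P <-> reduced L R (@coprod K x) P = 0.
Proof. by rewrite /primitive DeltaE tens1r tens1l; exact: eq_sub0r. Qed.

Lemma prim_basis : (2 : K) != 0 -> (3 : K) != 0 ->
  is_basis (Prim x 3) (tnth (Vs x br)).
Proof.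
move=> n2 n3.
have [Vprim Vfree Vspan] : is_basis
    (fun P => homogeneous 3 P /\ reduced L R (@coprod K x) P = 0)
    (tnth (Vs x br)).
  apply: (@hom_reduced_basis K x (HD K) (HD2 K) (in_alg (HD2 K)) L R
    (@coprod K x) br (@tenslZ _ _) (@tensrZ _ _) (@coprodZ K x) (bracket_nil K)
    (@coprod_bracket K x) (mcoeff mone) (@dcoef K) (@dcoefD K) (@dcoefN K)
    (@dcoefZ K) (@dcoef_mul K) (@br_counit K) (@dcoef_br K) mixed_eq0 a2_free
    n2 n3).
  - exact: homogeneousD.
  - exact: homogeneousN.
  - exact: homogeneousZ.
  - exact: homogeneous_basis3.
  - exact: homogeneous3_span.
split=> [i||w [hw /primitiveE rw]]; last by apply: Vspan.
  by have [hV rV] := Vprim i; split=> //; apply/primitiveE.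
exact: Vfree.
Qed.
End Dissection.

Theorem proposition10 (K : fieldType) (charK0 : [pchar K] =i pred0) (x : K) :
  let a := bracket K [:: 0]%N in
  let Y := bracket K [:: 2; 0]%N in
  let X := bracket K [:: 0; 0]%N in
  let W := bracket K [:: 0; 1]%N in
  let V1 := bracket K [:: 0; 1; 0]%N - x *: bracket K [:: 2; 0; 0]%N
    + x *: bracket K [:: 0; 0; 2]%N - (1 + x) *: (W * a)
    - (1 + x ^+ 2) *: (X * a) + x *: (Y * a) + (x ^+ 2 + 1) *: a ^+ 3 in
  let V2 := bracket K [:: 0; 1; 2]%N - x ^+ 2 *: bracket K [:: 2; 0; 0]%N
    + x *: bracket K [:: 0; 1; 1]%N - (1 + x) ^+ 2 *: (W * a)
    + (x * (x - 1)) *: (X * a) + x ^+ 2 *: (Y * a)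
    + ((x ^+ 3 - x ^+ 2 + 5 * x + 1) / 3) *: a ^+ 3 in
  let V3 := bracket K [:: 0; 0; 2]%N - bracket K [:: 0; 0; 0]%N - W * a
    - (x - 2) *: (X * a) + (x - 1) *: a ^+ 3 in
  let V4 := bracket K [:: 2; 0; 2]%N - bracket K [:: 3; 3; 0]%N - W * a + X * a
    - (x - 1) *: (Y * a) + (x - 1) *: a ^+ 3 in
  let V5 := bracket K [:: 0; 3; 1]%N - (1 + x) *: bracket K [:: 0; 0; 0]%N
    + bracket K [:: 2; 0; 2]%N - 2 *: (W * a) + (2 * (1 + x)) *: (X * a)
    - (1 + x) *: (Y * a) in
  let V6 := bracket K [:: 3; 1; 0]%N - bracket K [:: 2; 0; 2]%N in
  let V7 := bracket K [:: 2; 0; 0]%N - bracket K [:: 3; 1; 0]%N + W * a - X * a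
    + (x - 1) *: (Y * a) - (x - 1) *: a ^+ 3 in
  let V8 := bracket K [:: 0; 3; 0]%N - 2 *: (X * a) - Y * a + 2 *: a ^+ 3 in
  let V9 := bracket K [:: 2; 3; 0]%N - 3 *: (Y * a) + 2 *: a ^+ 3 in
  is_basis (Prim x 3) (tnth [tuple V1; V2; V3; V4; V5; V6; V7; V8; V9]).
Proof.
move=> a Y X W V1 V2 V3 V4 V5 V6 V7 V8 V9.
have natr_neq0 n : (n.+1%:R : K) != 0 by have /pcharf0P-> := charK0.
exact: prim_basis (natr_neq0 1%N) (natr_neq0 2).
Qed.
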